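(* Assume that $C$, $M_K$ and $M_{1,\alpha}$ (defined in the context) are finite, let $p_0\in\mathcal B_M$ be the initial density, and let $t\mapsto p_t\in C^1([0,T];C^{1,\alpha}(\mathcal O))$, with $p_t\in\mathcal B_M$ for all $t\in[0,T]$, be the unique solution of $\frac{d}{dt}p_t=p_tD(p_t)$ with $p_{t=0}=p_0$. Then there exists $t\in[0,T]$ such that $P_nD(p_t)\le\delta_n$.
   Context: Sample space and data: $d,n\in\mathbb N$ are fixed, $\mathcal O=[0,1]^d\times\{0,1\}\times\{0,1\}$, and $\mu$ is the product of Lebesgue measure on $[0,1]^d$ and counting measures on the two copies of $\{0,1\}$. $O_1,\dots,O_n\in\mathcal O$ are the observations, $O_k=(X_k,A_k,Y_k)$, and $P_nf:=\frac1n\sum_{i=1}^nf(O_i)$. Kernel: $K(o,o')=\exp(-\|o-o'\|_2^2/(2\sigma^2))$ on $\mathcal O\times\mathcal O$, with $\sigma>0$ fixed, is the Gaussian kernel; $\mathcal H_K$ is its reproducing kernel Hilbert space and $k_o=K(o,\cdot)$. Direction: for a probability density $p$ w.r.t. $\mu$, let $P_p$ be the measure with density $p$, $\mathcal H_{K,p}=\{f\in\mathcal H_K:P_p[f]=0\}$ (a closed subspace), $\Pi_p:\mathcal H_K\to\mathcal H_{K,p}$ the orthogonal projection, $k_o^{(p)}=\Pi_pk_o$, $K^{(p)}(o,o')=\langle k_o^{(p)},k_{o'}^{(p)}\rangle_{\mathcal H_K}$, $\alpha_j^{(p)}=\frac1n\sum_{i=1}^nK^{(p)}(O_i,O_j)$,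 and $$D(p):=\frac1n\sum_{j=1}^n\alpha_j^{(p)}\,k_{O_j}^{(p)}.$$ Hölder space: fix $\alpha\in(0,1]$. For $v$ on $[0,1]^d$, $\|v\|_{C^{1,\alpha}}=\|v\|_{L^\infty}+\sum_{i=1}^d\|\nabla_iv\|_{L^\infty}+\sum_{i=1}^d[\nabla_iv]_\alpha$ with $[w]_\alpha=\sup_{x\ne y}|w(x)-w(y)|/\|x-y\|_2^\alpha$. $C^{1,\alpha}(\mathcal O)$ is the Banach space of functions $u$ on $\mathcal O$ with $u(\cdot,a,y)\in C^{1,\alpha}([0,1]^d)$ for all $(a,y)\in\{0,1\}^2$, with norm $\|u\|_{C^{1,\alpha}(\mathcal O)}=\max_{(a,y)}\|u(\cdot,a,y)\|_{C^{1,\alpha}}$. Constants: $M>0$ is a radius (specified below) and $$\mathcal B_M=\Bigl\{p\in C^{1,\alpha}(\mathcal O):p\ge0,\ \int_{\mathcal O}p\,d\mu=1,\ \|p\|_{C^{1,\alpha}(\mathcal O)}\le M\Bigr\},$$ $$C=\sup_{o}K(o,o),\quad M_K=\sup_{y\in\mathcal O}\|K(\cdot,y)\|_{C^{1,\alpha}},\quad M_{1,\alpha}=\sup_{p\in\mathcal B_M}\sup_{1\le j\le n}\|k_{O_j}^{(p)}\|_{C^{1,\alpha}}.$$ Fix $\delta_n>0$ and put $w(\delta_n)=\delta_n/(2CM_{1,\alpha})$. For $k=1,\dots,n$ let $B(O_k,w(\delta_n))=\{(x,A_k,Y_k)\in\mathcal O:\|x-X_k\|_2<w(\delta_n)\}$.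 It is assumed that $p_0$ assigns positive mass to each $B(O_k,w(\delta_n))$. Set $$\mathfrak J(\delta_n)=\max_{1\le k\le n}\Bigl(\int_{B(O_k,w(\delta_n))}p_0\,d\mu\Bigr)^{-1},\qquad T=\frac{2}{\delta_n}\log\bigl(2\mathfrak J(\delta_n)\bigr),$$ $M_0=\|p_0\|_{C^{1,\alpha}(\mathcal O)}$, $C_{\mathrm{alg}}=1+2d^{(1-\alpha)/2}$. The radius $M$ is such that $$M=M_0\exp\bigl(C_{\mathrm{alg}}\,C\,M_{1,\alpha}\,T\bigr).$$ Since $M_{1,\alpha}$ (hence $T$) depends on $M$, this is understood as a relation that the fixed constants satisfy simultaneously. *)

(* Defs.v *)
From HB Require Import structures.
From mathcomp Require Import all_boot all_order all_algebra.
From mathcomp Require Import all_classical all_reals all_analysis.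
Set Implicit Arguments. Unset Strict Implicit. Unset Printing Implicit Defensive.
Import Order.TTheory GRing.Theory Num.Theory.
Import numFieldNormedType.Exports.
Local Open Scope classical_set_scope.
Local Open Scope ring_scope.

(* Lebesgue measure on R^n, as the n-fold product of [lebesgue_measure]. *)
Section tuple_lebesgue.
Context {R : realType}.
Local Notation RT := (measurableTypeR R).

Definition tuple_cons n (x : RT * n.-tuple RT) : n.+1.-tuple RT :=
  [tuple of x.1 :: x.2].

Let measurable_tuple_cons n : measurable_fun setT (@tuple_cons n).
Proof. exact: measurable_cons. Qed.

Section cons.
Variables (n : nat) (m : {sigma_finite_measure set (n.-tuple RT) -> \bar R}).

Definition lebesgue_cons : set (n.+1.-tuple RT) -> \bar R :=
  pushforward (@lebesgue_measure R \x m)%E (@tuple_cons n).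

HB.instance Definition _ := Measure.copy lebesgue_cons
  (measure_function_pushforward__canonical__measure_function_Measure
    (@lebesgue_measure R \x m)%E (@measurable_tuple_cons n)).

Let lebesgue_cons_sigma_finite : sigma_finite setT lebesgue_cons.
Proof.
have /sigma_finiteP[F [FT ndF Foo]] := sigma_finiteT (@lebesgue_measure R).
have /sigma_finiteP[G [GT ndG Goo]] := sigma_finiteT m.
pose g (x : n.+1.-tuple RT) := (tnth x ord0, [tuple of behead x] : n.-tuple RT).
have gK x : g (tuple_cons x) = x.
  by case: x => a x; congr pair; apply/val_inj.
have mg : measurable_fun setT g.
  apply/measurable_fun_pairP; split; first exact: measurable_tnth.
  exact: measurable_behead.
exists (fun k => g @^-1` (F k `*` G k)).
  apply/seteqP; split=> // x _.
  have : [set: RT] (g x).1 by [].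
  rewrite FT => -[i _ Fi].
  have : [set: n.-tuple RT] (g x).2 by [].
  rewrite GT => -[j _ Gj].
  exists (maxn i j) => //; split.
    by move: Fi; exact/subsetPset/ndF/leq_maxl.
  by move: Gj; exact/subsetPset/ndG/leq_maxr.
move=> k; have [mF Fk] := Foo k; have [mG Gk] := Goo k; split.
  by rewrite -[X in measurable X]setTI; apply: mg => //; exact: measurableX.
rewrite /lebesgue_cons /pushforward (_ : _ @^-1` _ = F k `*` G k).
  by rewrite product_measure1E// lte_mul_pinfty// ge0_fin_numE.
by rewrite -comp_preimage (_ : g \o _ = id) ?preimage_id//; exact/funext.
Qed.

HB.instance Definition _ := Measure_isSigmaFinite.Build _ _ _ lebesgue_cons
  lebesgue_cons_sigma_finite.
End cons.

Fixpoint tuple_lebesgue n :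
    {sigma_finite_measure set (n.-tuple RT) -> \bar R} :=
  if n is k.+1 then lebesgue_cons (tuple_lebesgue k)
  else \d_([tuple] : 0.-tuple RT).
End tuple_lebesgue.

Section cube.
Context {R : realType}.
Local Notation RT := (measurableTypeR R).

Definition cube_set d : set (d.-tuple RT) :=
  [set x | forall i, 0 <= (tnth x i : R) <= 1].

Definition cube d : Type := cube_set (d := d).

Definition coord d (x : cube d) (i : 'I_d) : R := tnth (val x) i.

Let cube0 d : ([tuple of nseq d (0 : R)] : d.-tuple RT) \in cube_set (d := d).
Proof. by apply/mem_set => i /=; rewrite tnth_nseq lexx ler01. Qed.

HB.instance Definition _ d := Choice.on (cube d).
HB.instance Definition _ d := isPointed.Build (cube d) (SigSub (cube0 d)).
HB.instance Definition _ d := Measurable.copy (cube d)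
  (g_sigma_algebra_preimageType (set_val : cube d -> d.-tuple RT)).

Lemma measurable_cube_set d : measurable (@cube_set d).
Proof.
rewrite (_ : cube_set (d := d) =
    \bigcap_(i in [set: 'I_d]) ((@tnth d RT)^~ i @^-1` `[0, 1]%classic)).
  apply: fin_bigcap_measurable => // i _.
  rewrite -[X in measurable X]setTI.
  by apply: measurable_tnth => //; exact: measurable_itv.
apply/seteqP; split=> x /= xP i; last by have := xP i Logic.I; rewrite /= in_itv.
by move=> _; rewrite /= in_itv /=; exact: xP.
Qed.

Let measurable_image d (A : set (cube d)) : measurable A ->
  measurable (set_val @` A : set (d.-tuple RT)).
Proof.
case=> B mB; rewrite setTI => <-.
rewrite (_ : _ @` _ = cube_set (d := d) `&` B).
  by apply: measurableI => //; exact: measurable_cube_set.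
apply/seteqP; split=> [_ [x Bx <-]|x [xC Bx]]; first by split=> //; exact: set_valP.
by exists (SigSub (mem_set xC)).
Qed.

Definition cube_lebesgue d (A : set (cube d)) : \bar R :=
  tuple_lebesgue d (set_val @` A).

Let cube_lebesgue0 d : cube_lebesgue (set0 : set (cube d)) = 0%E.
Proof. by rewrite /cube_lebesgue image_set0 measure0. Qed.

Let cube_lebesgue_ge0 d (A : set (cube d)) : (0 <= cube_lebesgue A)%E.
Proof. exact: measure_ge0. Qed.

Let cube_lebesgue_sigma_additive d : semi_sigma_additive (@cube_lebesgue d).
Proof.
move=> F mF tF mUF; rewrite /cube_lebesgue image_bigcup.
apply: measure_semi_sigma_additive.
- by move=> k; exact: measurable_image.
- apply/trivIsetP => i j _ _ ij; apply/seteqP; split=> // _ [[x Fx <-] [y Fy]].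
  move=> /val_inj yx; move/trivIsetP : tF => /(_ i j Logic.I Logic.I ij).
  by move=> /seteqP[/(_ x) + _]; apply; split=> //; rewrite -yx.
- by rewrite -image_bigcup; exact: measurable_image.
Qed.

HB.instance Definition _ d := isMeasure.Build _ _ _ (@cube_lebesgue d)
  (@cube_lebesgue0 d) (@cube_lebesgue_ge0 d) (@cube_lebesgue_sigma_additive d).

(* `counting` itself is only registered as sigma-finite on `nat`. *)
Definition counting_bool : set bool -> \bar R := counting.
HB.instance Definition _ := Measure.on counting_bool.
Let counting_bool_fin : fin_num_fun counting_bool.
Proof.
by move=> A _; rewrite /counting_bool /counting asboolT//; exact: finite_finset.
Qed.
HB.instance Definition _ := Measure_isFinite.Build _ _ _ counting_bool
  counting_bool_fin.

Definition obs d : Type := (cube d * bool * bool)%type.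
HB.instance Definition _ d := Measurable.on (obs d).

Definition obs_measure d : set (obs d) -> \bar R :=
  (@cube_lebesgue d \x counting_bool \x counting_bool)%E.
HB.instance Definition _ d := Measure.on (@obs_measure d).
End cube.

Arguments cube_set R d : clear implicits.
Arguments cube R d : clear implicits.
Arguments obs R d : clear implicits.
Arguments obs_measure R d : clear implicits.

Section gaussian_kernel.
Context {R : realType} {d : nat}.

Definition cube_dist (x y : cube R d) : R :=
  Num.sqrt (\sum_(i < d) (coord x i - coord y i) ^+ 2).

(* O is a subset of R^(d+2): the two labels count as coordinates 0 or 1. *)
Definition obs_dist (o o' : obs R d) : R :=
  Num.sqrt (\sum_(i < d) (coord o.1.1 i - coord o'.1.1 i) ^+ 2
            + (o.1.2%:R - o'.1.2%:R) ^+ 2 + (o.2%:R - o'.2%:R) ^+ 2).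

Definition gauss_kernel (sigma : R) (o o' : obs R d) : R :=
  expR (- (obs_dist o o' ^+ 2 / (2 * sigma ^+ 2))).

End gaussian_kernel.

(* The carrier is a set [H] of functions, with inner product [ip]; values of  *)
(* [ip] outside [H] are irrelevant.                                           *)
Record is_rkhs {R : realType} {X : Type} (K : X -> X -> R)
    (H : set (X -> R)) (ip : (X -> R) -> (X -> R) -> R) : Prop := IsRKHS {
  rkhs_zero : H 0 ;
  rkhs_lin : forall (a : R) f g, H f -> H g -> H (a *: f + g) ;
  rkhs_ipC : forall f g, H f -> H g -> ip f g = ip g f ;
  rkhs_ip_lin : forall (a : R) f g h, H f -> H g -> H h ->
    ip (a *: f + g) h = a * ip f h + ip g h ;
  rkhs_ip_gt0 : forall f, H f -> f <> 0 -> 0 < ip f f ;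
  rkhs_complete : forall u : nat -> X -> R, (forall m, H (u m)) ->
    (forall e : R, 0 < e -> exists N, forall m k, (N <= m)%N -> (N <= k)%N ->
       Num.sqrt (ip (u m - u k) (u m - u k)) < e) ->
    exists2 f, H f &
      Num.sqrt (ip (u m - f) (u m - f)) @[m --> \oo] --> (0 : R) ;
  rkhs_kernel : forall x, H (K x) ;
  rkhs_reproducing : forall f x, H f -> ip f (K x) = f x }.

Definition is_orth_proj {R : realType} {X : Type}
    (ip : (X -> R) -> (X -> R) -> R) (V : set (X -> R)) (f g : X -> R) : Prop :=
  V g /\ forall h, V h -> ip (f - g) h = 0.

Definition orth_proj {R : realType} {X : Type}
    (ip : (X -> R) -> (X -> R) -> R) (V : set (X -> R)) (f : X -> R) : X -> R :=
  get (is_orth_proj ip V f).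

Section holder.
Context {R : realType} {d : nat}.
Variable alpha : R.
Implicit Types (v w : cube R d -> R) (x : cube R d) (u : obs R d -> R).
Local Notation RT := (measurableTypeR R).

Definition translate x (i : 'I_d) (h : R) : d.-tuple RT :=
  [tuple if j == i then coord x j + h else coord x j | j < d].

(* Increments [h] for which x + h e_i stays in the cube, so that partial      *)
(* derivatives are one-sided on the faces.                                    *)
Definition admissible x (i : 'I_d) : set R :=
  [set h | cube_set R d (translate x i h)].

Definition diff_quotient v (i : 'I_d) x (h : R) : R :=
  h^-1 * ('valL_0 v (translate x i h) - v x).

Definition has_partials v : Prop := forall i x,
  cvg (diff_quotient v i x h @[h --> within (admissible x i) 0^']).

Definition partial (i : 'I_d) v x : R :=
  lim (diff_quotient v i x h @[h --> within (admissible x i) 0^']).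

Definition sup_norm v : \bar R := ereal_sup (range (fun x => `|v x|%:E)).

Definition holder_seminorm w : \bar R :=
  ereal_sup [set (`|w xy.1 - w xy.2| / cube_dist xy.1 xy.2 `^ alpha)%:E
            | xy in [set xy | xy.1 <> xy.2]].

(* Finite exactly on C^{1,alpha}([0,1]^d); the continuity of the partial      *)
(* derivatives follows from the finiteness of their Hoelder seminorms.        *)
Definition C1a_cube_norm v : \bar R :=
  if `[< has_partials v >] then
    (sup_norm v + \sum_(i < d) sup_norm (partial i v)
     + \sum_(i < d) holder_seminorm (partial i v))%E
  else +oo%E.

Definition C1a_norm u : \bar R :=
  \big[maxe/0%E]_(ay : bool * bool)
    C1a_cube_norm (fun x => u (x, ay.1, ay.2)).

Definition in_C1a u : Prop := (C1a_norm u < +oo)%E.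

(* [p] belongs to C^1([0, T]; C^{1,alpha}) and has time derivative [q].       *)
Definition C1_curve_with_derivative (T : R) (p q : R -> obs R d -> R) : Prop :=
  [/\ forall t, 0 <= t <= T -> in_C1a (p t),
      forall t, 0 <= t <= T -> in_C1a (q t),
      forall t, 0 <= t <= T ->
        C1a_norm (h^-1 *: (p (t + h) - p t) - q t)
          @[h --> within [set h | 0 <= t + h <= T] 0^'] --> 0%E
    & forall t, 0 <= t <= T ->
        C1a_norm (q s - q t)
          @[s --> within [set s | 0 <= s <= T] (nbhs t)] --> 0%E].

Definition density_ball (M : R) : set (obs R d -> R) :=
  [set p | [/\ forall o, 0 <= p o,
               (\int[obs_measure R d]_o (p o)%:E = 1)%E
             & (C1a_norm p <= M%:E)%E]].

End holder.

Section direction.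
Context {R : realType} {d n : nat}.
Variables (K : obs R d -> obs R d -> R).
Variables (HK : set (obs R d -> R)) (ip : (obs R d -> R) -> (obs R d -> R) -> R).
Variable Ob : 'I_n -> obs R d.
Implicit Types (p f : obs R d -> R).

Definition empirical f : R := n%:R^-1 * \sum_(i < n) f (Ob i).

Definition mean_zero p : set (obs R d -> R) :=
  HK `&` [set f | \int[obs_measure R d]_o (f o * p o) = 0].

Definition proj_section p (o : obs R d) : obs R d -> R :=
  orth_proj ip (mean_zero p) (K o).

Definition proj_kernel p (o o' : obs R d) : R :=
  ip (proj_section p o) (proj_section p o').

Definition weight p (j : 'I_n) : R :=
  n%:R^-1 * \sum_(i < n) proj_kernel p (Ob i) (Ob j).

Definition direction p : obs R d -> R :=
  n%:R^-1 *: \sum_(j < n) weight p j *: proj_section p (Ob j).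

End direction.

Section constants.
Context {R : realType} {d n : nat}.
Variables (K : obs R d -> obs R d -> R).
Variables (HK : set (obs R d -> R)) (ip : (obs R d -> R) -> (obs R d -> R) -> R).
Variables (alpha : R) (Ob : 'I_n -> obs R d).

Definition kernel_sup : \bar R := ereal_sup (range (fun o => (K o o)%:E)).

Definition kernel_C1a_sup : \bar R :=
  ereal_sup (range (fun y => C1a_norm alpha (fun o => K o y))).

Definition section_C1a_sup (M : R) : \bar R :=
  ereal_sup [set C1a_norm alpha (proj_section K HK ip pj.1 (Ob pj.2))
            | pj in density_ball alpha M `*` [set: 'I_n]].

Definition obs_ball (w : R) (k : 'I_n) : set (obs R d) :=
  [set o | [/\ o.1.2 = (Ob k).1.2, o.2 = (Ob k).2
             & cube_dist o.1.1 (Ob k).1.1 < w]].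

Definition ball_mass (p : obs R d -> R) (w : R) (k : 'I_n) : R :=
  \int[obs_measure R d]_(o in obs_ball w k) p o.

Definition ball_radius (delta C M1a : R) : R := delta / (2 * C * M1a).

Definition inv_mass_max (p0 : obs R d -> R) (w : R) : R :=
  \big[Num.max/0]_(k < n) (ball_mass p0 w k)^-1.

Definition horizon (delta J : R) : R := 2 / delta * ln (2 * J).

End constants.

Definition C_alg {R : realType} (d : nat) (alpha : R) : R :=
  1 + 2 * d%:R `^ ((1 - alpha) / 2).

Definition is_solution {R : realType} {d n : nat} (K : obs R d -> obs R d -> R)
    (HK : set (obs R d -> R)) (ip : (obs R d -> R) -> (obs R d -> R) -> R)
    (alpha : R) (Ob : 'I_n -> obs R d) (M T : R) (p0 : obs R d -> R)
    (p : R -> obs R d -> R) : Prop :=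
  [/\ p 0 = p0,
      forall t, 0 <= t <= T -> density_ball alpha M (p t)
    & C1_curve_with_derivative alpha T p
        (fun t => p t \* direction K HK ip Ob (p t))].

(* Main.v *)
Require Import Defs.
From mathcomp Require Import all_boot all_order all_algebra.
From mathcomp Require Import all_classical all_reals all_analysis.
From mathcomp Require Import ring lra.
Import Order.TTheory GRing.Theory Num.Theory.
Import numFieldNormedType.Exports.
Local Open Scope classical_set_scope.
Local Open Scope ring_scope.

(** Suppose that the empirical mean of the direction stays above [delta] on the
whole interval [[0, T]].  Each projected section has squared RKHS norm at most
[C], so the weights are bounded by [C], and each has C^{1,alpha} norm at most
[M1a].  Hence the direction is Lipschitz in [x] with constant [C * M1a]
([direction_lipschitz]), and on the ball of radius
[w = delta / (2 * C * M1a)] around an observation it differs from its value at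
that observation by at most [delta / 2].

Pick one point [z k] in the ball around each observation [Ob k].  The flow
[p' = p * direction p] makes the product of the [p t (z k)] over [k] satisfy
[f' = f * g], where [g t] is the sum over [k] of the direction at [z k].  Now
[g] is at least the sum of the directions at the [Ob k] minus [n * delta / 2],
that is at least [n * delta / 2], so the product grows at least by the factor
[expR (n * delta / 2 * T)] over [[0, T]] ([prod_exp_growth]).

On the other hand, [expR (delta / 2 * T) = 2 * J] by the choice of [T], and [J]
times the initial mass of any of the balls is at least [1].  If [p T] were at
least [2 * J] times [p0] on the whole of a ball, it would give that ball a mass
of at least [2], although its total mass is [1] ([density_ball_mass]).  So every
ball contains a point [z k] with [p T (z k) < expR (delta / 2 * T) * p0 (z k)].
Multiplying these inequalities contradicts the growth of the product.

The product is used and not the sum of the logarithms, so that [p t] need not be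
shown to stay positive at the [z k]. *)

(* Vector spaces also have a function [coord]: here it is that of the cube. *)
Local Notation coord := Defs.coord.

(** * Derivatives within a set *)

(** One-sided at the end points of an interval, as needed both for partial
derivatives on the faces of the cube and for curves on a closed time
interval. *)
Definition derives_within {R : realType} (A : set R) (f : R -> R) (s l : R) :=
  h^-1 * (f (s + h) - f s) @[h --> within [set h | A (s + h)] 0^'] --> l.

Lemma derives_within_continuous {R : realType} (A : set R) (f : R -> R) s l :
  derives_within A f s l -> f x @[x --> within A (nbhs s)] --> f s.
Proof.
move=> /cvgrPdist_lt/(_ 1 ltr01) fl.
apply/cvgrPdist_lt => e e0.
(* Close to [s], the difference quotients are smaller than [`|l| + 1]. *)
have B0 : 0 < `|l| + 1 by rewrite ltr_wpDl.
have /nbhs_ballP[r /= r0 fr] : nbhs 0 (fun h : R => h != 0 -> A (s + h) ->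
    `|l - h^-1 * (f (s + h) - f s)| < 1) := fl.
apply/nbhs_ballP; exists (Num.min r (e / (`|l| + 1))) => /=.
  by rewrite lt_min r0 divr_gt0.
move=> x; rewrite /ball/= lt_min => /andP[xr xe] Ax.
have [->|xs] := eqVneq x s; first by rewrite subrr normr0.
have xs0 : x - s != 0 by rewrite subr_eq0.
have := fr (x - s); rewrite /ball /= sub0r normrN [`|x - s|]distrC.
move=> /(_ xr xs0); rewrite (addrC s) subrK => /(_ Ax) lq.
have : `|(x - s)^-1 * (f x - f s)| < `|l| + 1.
  rewrite -[X in `|X|](subrK l) addrC (le_lt_trans (ler_normD _ _))//.
  by rewrite ltrD2l distrC.
rewrite normrM normfV mulrC ltr_pdivrMr ?normr_gt0// => fxs.
rewrite distrC (lt_le_trans fxs)// -ler_pdivlMl//; rewrite distrC mulrC.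
exact: ltW.
Qed.

Lemma derives_within_is_derive {R : realType} (a b : R) (f : R -> R) s l :
  s \in `]a, b[ -> derives_within `[a, b] f s l -> is_derive s 1 f l.
Proof.
rewrite in_itv /= => /andP[sa sb] fl.
have fl' : h^-1 *: (f (h *: 1 + s) - f s) @[h --> 0^'] --> l.
  move=> U /fl Ul0.
  have Ul : nbhs 0 (fun h : R => h != 0 -> s + h \in `[a, b] ->
      U (h^-1 * (f (s + h) - f s))) := Ul0.
  have : nbhs (0 : R) (fun h => s + h \in `[a, b]).
    have e0 : 0 < Num.min (s - a) (b - s) by rewrite lt_min !subr_gt0 sa.
    apply: filterS (nbhs0_lt (V := R^o) e0) => h.
    rewrite lt_min !ltr_norml in_itv /= => /andP[/andP[? ?] /andP[? ?]].
    by apply/andP; split; lra.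
  apply: filterS2 Ul => h Uh sh h0.
  rewrite /preimage /= [h *: 1]mulr1 (addrC h); exact: Uh.
apply: DeriveDef; first by apply/cvg_ex; exists l.
exact/cvg_lim.
Qed.

Lemma derives_within_MVT {R : realType} (a b : R) (f df : R -> R) : a < b ->
  (forall s, s \in `[a, b] -> derives_within `[a, b] f s (df s)) ->
  exists2 c, c \in `]a, b[ & f b - f a = df c * (b - a).
Proof.
move=> ab fdf; apply: MVT => // [s sab|].
  apply: derives_within_is_derive (sab) _; apply: fdf.
  exact: subset_itv_oo_cc.
apply/subspace_continuousP => s /= sab.
exact: derives_within_continuous (fdf _ sab).
Qed.

(** * Functions with bounded partial derivatives are Lipschitz *)

Section partial.
Context {R : realType} {d : nat}.
Implicit Types (x y : cube R d) (v : cube R d -> R).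

Lemma cube_eqP x y : (forall i, coord x i = coord y i) -> x = y.
Proof.
by move=> xy; apply: (@val_inj _ _ (cube_set R d)); exact: eq_from_tnth.
Qed.

Lemma coord_itv x i : 0 <= coord x i <= 1.
Proof. exact: (set_valP x). Qed.

Lemma valL_cube v x : 'valL_0 v (val x : d.-tuple (measurableTypeR R)) = v x.
Proof. by rewrite /valL_ /= oinv_set_val valK. Qed.

Lemma translate_interval x i (a b h : R) :
  admissible x i a -> admissible x i b -> a <= h <= b -> admissible x i h.
Proof.
move=> Aa Ab /andP[ah hb] j; move: (Aa j) (Ab j).
rewrite !tnth_mktuple; case: eqP => // _ /andP[? ?] /andP[? ?].
by apply/andP; split; lra.
Qed.

Lemma translate_coord x i h : admissible x i h ->
  exists2 y, (forall j, coord y j = coord x j + (j == i)%:R * h)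
     & val y = translate x i h.
Proof.
move=> Ah; have At : cube_set R d (translate x i h) := Ah.
exists (SigSub (mem_set At) : cube R d) => // j.
by rewrite /coord tnth_mktuple; case: eqP => _; rewrite ?mul1r// mul0r addr0.
Qed.

(** The mean value theorem for the restriction of [v] to the line through [x] in
the direction [i].  The partial derivatives are one-sided where this line leaves
the cube. *)
Lemma slice_lipschitz v i (L : R) x a b : has_partials v ->
  a <= b -> admissible x i a -> admissible x i b ->
  (forall y, `|partial i v y| <= L) ->
  `|'valL_0 v (translate x i b) - 'valL_0 v (translate x i a)| <= L * (b - a).
Proof.
move=> pv; rewrite le_eqVlt => /predU1P[->|ab] Aa Ab vL.
  by rewrite !subrr normr0 mulr0.
pose f s := 'valL_0 v (translate x i s).
have fdf s : s \in `[a, b] -> exists2 y, val y = translate x i s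
    & derives_within `[a, b] f s (partial i v y).
  rewrite in_itv /= => sab.
  have As := translate_interval _ _ _ _ _ Aa Ab sab.
  have [y yx ey] := translate_coord _ _ _ As.
  have yh h : translate y i h = translate x i (s + h).
    apply: eq_from_tnth => j; rewrite !tnth_mktuple yx.
    by case: eqP => _; rewrite ?mul1r ?addrA// mul0r addr0.
  exists y => // U /(pv i y) UA.
  have : \forall h \near 0^',
      admissible y i h -> U (diff_quotient v i y h) := UA.
  apply: filterS => h /= Uh /[!in_itv]/= sh.
  rewrite /f -yh -ey valL_cube; apply: Uh.
  rewrite /admissible/= yh.
  exact: (translate_interval _ _ _ _ _ Aa Ab sh).
(* The increments [s] are real numbers and not points of the cube, so the
   derivative along the line is chosen as a function of [s]. *)
pose Df s := get [set l | derives_within `[a, b] f s l /\ `|l| <= L].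
have DfP s : s \in `[a, b] -> derives_within `[a, b] f s (Df s) /\ `|Df s| <= L.
  move=> /fdf[y _ fy]; have /getPex// : exists l,
    [set l | derives_within `[a, b] f s l /\ `|l| <= L] l.
  by exists (partial i v y).
have [|c cab ->] := derives_within_MVT a b f Df ab.
  by move=> s /DfP[].
have ba : 0 <= b - a by rewrite subr_ge0 ltW.
rewrite normrM (ger0_norm ba) ler_wpM2r//.
by have [] := DfP c (subset_itv_oo_cc cab).
Qed.

Lemma one_coord_lipschitz v i (L : R) x y : has_partials v ->
  (forall z, `|partial i v z| <= L) ->
  (forall j, j != i -> coord x j = coord y j) ->
  `|v x - v y| <= L * `|coord x i - coord y i|.
Proof.
move=> pv vL; wlog xy : x y / coord y i <= coord x i => [th|] exy.
  have [/th|/ltW/th] := leP (coord y i) (coord x i); first exact.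
  rewrite distrC (distrC (coord x i)); apply => j /exy; exact: esym.
have y0 : translate y i 0 = val y.
  by apply: eq_from_tnth => j; rewrite tnth_mktuple addr0 if_same.
have yx : translate y i (coord x i - coord y i) = val x.
  apply: eq_from_tnth => j; rewrite tnth_mktuple.
  by case: eqP => [->|/eqP /exy <-//]; rewrite addrC subrK.
have xy0 : 0 <= coord x i - coord y i by rewrite subr_ge0.
have := slice_lipschitz v i L y 0 (coord x i - coord y i) pv xy0.
rewrite subr0 y0 yx !valL_cube (ger0_norm xy0); apply => //.
- by rewrite /admissible /= y0; exact: set_valP.
- by rewrite /admissible /= yx; exact: set_valP.
Qed.

(** Walk from [x] to [y] by changing one coordinate at a time: in a product of
intervals, this path never leaves the domain. *)
Lemma partials_lipschitz v (L : 'I_d -> R) x y : has_partials v ->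
  (forall i z, `|partial i v z| <= L i) ->
  `|v x - v y| <= \sum_i L i * `|coord x i - coord y i|.
Proof.
move=> pv vL.
have zP k : cube_set R d
    [tuple if (i < k)%N then coord y i else coord x i | i < d].
  by move=> i; rewrite tnth_mktuple; case: ifP => _; exact: coord_itv.
pose z k : cube R d := SigSub (mem_set (zP k)).
have zE k i : coord (z k) i = if (i < k)%N then coord y i else coord x i.
  by rewrite /coord tnth_mktuple.
suff main k : (k <= d)%N ->
    `|v x - v (z k)| <= \sum_(i < d | (i < k)%N) L i * `|coord x i - coord y i|.
  have := main d (leqnn d).
  rewrite (_ : z d = y); last by apply: cube_eqP => i; rewrite zE ltn_ord.
  by rewrite (eq_bigl predT)// => i; rewrite ltn_ord.
elim: k => [_|k IH kd].
  rewrite (_ : z 0%N = x); last by apply: cube_eqP => i; rewrite zE.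
  by rewrite subrr normr0 big_pred0.
rewrite -(subrK (v (z k)) (v x)) -addrA (le_trans (ler_normD _ _))//.
rewrite (bigD1 (Ordinal kd))//= [leRHS]addrC lerD//; last first.
  have zz j : j != Ordinal kd -> coord (z k) j = coord (z k.+1) j.
    move=> jk; rewrite !zE ltnS [in RHS]leq_eqVlt.
    by rewrite (negbTE (jk : (j : nat) != k)).
  have := one_coord_lipschitz v (Ordinal kd) _ (z k) (z k.+1) pv (vL _) zz.
  by rewrite !zE /= ltnn leqnn.
rewrite (le_trans (IH (ltnW kd)))// le_eqVlt; apply/orP; left; apply/eqP.
apply: eq_bigl => i; rewrite ltnS andbC [in RHS]leq_eqVlt.
have [->|ik] := eqVneq i (Ordinal kd); first by rewrite /= ltnn.
by rewrite (negbTE (ik : (i : nat) != k)).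
Qed.

Lemma coord_dist x y i : `|coord x i - coord y i| <= cube_dist x y.
Proof.
rewrite -sqrtr_sqr ler_wsqrtr// (bigD1 i)//= lerDl sumr_ge0// => j _.
exact: sqr_ge0.
Qed.

End partial.

(** * Consequences of a bound on the Hoelder norm *)

Section norm.
Context {R : realType} {d : nat}.
Context (alpha : R).
Implicit Types (x y : cube R d) (v : cube R d -> R) (u : obs R d -> R).

Lemma sup_norm_ub v x : (`|v x|%:E <= sup_norm v)%E.
Proof. by apply: ereal_sup_ubound; exists x. Qed.

Lemma sup_norm_ge0 v : (0 <= sup_norm v)%E.
Proof. exact: le_trans (sup_norm_ub v point). Qed.

Lemma cube_has_two_points : 'I_d -> exists x y : cube R d, x <> y.
Proof.
move=> i.
have cst (c : R) : 0 <= c <= 1 -> cube_set R d [tuple of nseq d c].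
  by move=> c01 j; rewrite tnth_nseq.
have c0 : 0 <= (0 : R) <= 1 by rewrite lexx ler01.
have c1 : 0 <= (1 : R) <= 1 by rewrite lexx ler01.
exists (SigSub (mem_set (cst _ c0))), (SigSub (mem_set (cst _ c1))).
move=> /(congr1 (fun x : cube R d => coord x i)).
by rewrite /coord !tnth_nseq => /esym/eqP; rewrite oner_eq0.
Qed.

(** The supremum over pairs of distinct points would be [-oo] if there were no
such pair, that is, on the cube of dimension [0]. *)
Lemma holder_seminorm_ge0 v : 'I_d -> (0 <= holder_seminorm alpha v)%E.
Proof.
move=> /cube_has_two_points[x [y xy]].
apply: (@le_trans _ _ (`|v x - v y| / cube_dist x y `^ alpha)%:E).
  by rewrite lee_fin divr_ge0// powR_ge0.
by apply: ereal_sup_ubound; exists (x, y).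
Qed.

Lemma C1a_cube_norm_le v (L : R) : (C1a_cube_norm alpha v <= L%:E)%E ->
  has_partials v /\
  (sup_norm v + \sum_(i < d) sup_norm (partial i v) <= L%:E)%E.
Proof.
rewrite /C1a_cube_norm; case: asboolP => // pv vL; split => //.
apply: le_trans vL; rewrite leeDl//.
by apply: sume_ge0 => i _; exact: holder_seminorm_ge0.
Qed.

Lemma C1a_cube_norm_bounded v (L : R) x :
  (C1a_cube_norm alpha v <= L%:E)%E -> `|v x| <= L.
Proof.
move=> /C1a_cube_norm_le[_ vL]; rewrite -lee_fin (le_trans (sup_norm_ub v x))//.
by rewrite (le_trans _ vL)// leeDl// sume_ge0// => i _; exact: sup_norm_ge0.
Qed.

(** The norm adds up the suprema of the partial derivatives, so it bounds the
Lipschitz constant even for the sup distance. *)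
Lemma C1a_cube_norm_lipschitz v (L : R) x y :
  (C1a_cube_norm alpha v <= L%:E)%E -> `|v x - v y| <= L * cube_dist x y.
Proof.
move=> /C1a_cube_norm_le[pv vL].
have sL : (\sum_(i < d) sup_norm (partial i v) <= L%:E)%E.
  by apply: le_trans vL; rewrite leeDr// sup_norm_ge0.
have sfin i : sup_norm (partial i v) \is a fin_num.
  rewrite ge0_fin_numE ?sup_norm_ge0// (le_lt_trans _ (ltry L))//.
  apply: le_trans sL; rewrite (bigD1 i)//= leeDl// sume_ge0// => j _.
  exact: sup_norm_ge0.
pose l i := fine (sup_norm (partial i v)).
have vl i z : `|partial i v z| <= l i by rewrite -lee_fin fineK// sup_norm_ub.
have lL : \sum_i l i <= L.
  by rewrite -lee_fin -sumEFin; under eq_bigr do rewrite fineK//.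
rewrite (le_trans (partials_lipschitz v l x y pv vl))//.
rewrite (@le_trans _ _ (\sum_i l i * cube_dist x y))//.
  apply: ler_sum => i _; rewrite ler_wpM2l ?coord_dist//.
  exact: le_trans (vl i x).
by rewrite -mulr_suml ler_wpM2r// sqrtr_ge0.
Qed.

Lemma C1a_norm_ge_section u a b :
  (C1a_cube_norm alpha (fun x => u (x, a, b)) <= C1a_norm alpha u)%E.
Proof.
exact: (le_bigmax 0%E (fun ay : bool * bool =>
  C1a_cube_norm alpha (fun x => u (x, ay.1, ay.2))) (a, b)).
Qed.

Lemma C1a_norm_ge0 u : (0 <= C1a_norm alpha u)%E.
Proof. exact: bigmax_ge_id. Qed.

Lemma C1a_norm_ub u o : (`|u o|%:E <= C1a_norm alpha u)%E.
Proof.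
case: o => -[x a] b; have := C1a_norm_ge_section u a b.
case: (C1a_norm alpha u) (C1a_norm_ge0 u) => [L _|_ _|//]; last exact: leey.
by move=> /(C1a_cube_norm_bounded _ _ x).
Qed.

Lemma C1a_norm_lipschitz u (L : R) o o' : (C1a_norm alpha u <= L%:E)%E ->
  o.1.2 = o'.1.2 -> o.2 = o'.2 ->
  `|u o - u o'| <= L * cube_dist o.1.1 o'.1.1.
Proof.
case: o o' => -[x a] b [[y a'] b'] /= uL <- <-.
apply: (C1a_cube_norm_lipschitz (fun x => u (x, a, b)) L x y).
exact: le_trans (C1a_norm_ge_section u a b) uL.
Qed.

End norm.

(** * Lipschitz bound on the direction *)

Section rkhs.
Context {R : realType} {X : Type} (K : X -> X -> R).
Context (H : set (X -> R)) (ip : (X -> R) -> (X -> R) -> R).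
Context (HK : is_rkhs K H ip).

Lemma rkhs_sub f g : H f -> H g -> H (f - g).
Proof.
move=> Hf Hg.
rewrite (_ : f - g = (-1) *: g + f); last by rewrite scaleN1r addrC.
exact: (rkhs_lin HK).
Qed.

Lemma rkhs_ip0l h : H h -> ip 0 h = 0.
Proof.
move=> Hh; have H0 := rkhs_zero HK.
by have := rkhs_ip_lin HK (-1) H0 H0 Hh; rewrite scaler0 addr0 mulN1r addNr.
Qed.

Lemma rkhs_ip_ge0 f : H f -> 0 <= ip f f.
Proof.
move=> Hf; have [->|/eqP f0] := eqVneq f 0.
  by rewrite rkhs_ip0l//; exact: rkhs_zero HK.
exact/ltW/(rkhs_ip_gt0 HK).
Qed.

Lemma rkhs_ip_add f g h : H f -> H g -> H h -> ip (f + g) h = ip f h + ip g h.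
Proof.
by move=> Hf Hg Hh; rewrite -(scale1r f) (rkhs_ip_lin HK)// mul1r scale1r.
Qed.

Lemma rkhs_ip_opp f h : H f -> H h -> ip (- f) h = - ip f h.
Proof.
move=> Hf Hh; rewrite -scaleN1r -[X in ip X]addr0 (rkhs_ip_lin HK)//.
  by rewrite rkhs_ip0l// mulN1r addr0.
exact: rkhs_zero HK.
Qed.

Lemma rkhs_ip_norm_sub f g : H f -> H g ->
  ip (f - g) (f - g) = ip f f - 2 * ip f g + ip g g.
Proof.
move=> Hf Hg; have Hfg := rkhs_sub _ _ Hf Hg.
have Hg' : H (- g).
  by rewrite -sub0r; apply: rkhs_sub => //; exact: rkhs_zero HK.
rewrite rkhs_ip_add// rkhs_ip_opp//.
rewrite (rkhs_ipC HK Hf Hfg) (rkhs_ipC HK Hg Hfg) !rkhs_ip_add//.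
by rewrite !rkhs_ip_opp// (rkhs_ipC HK Hg Hf); ring.
Qed.

(** Expand the squared norms of [f + g] and [f - g], which are nonnegative. *)
Lemma rkhs_ip_le (c : R) f g : H f -> H g ->
  ip f f <= c -> ip g g <= c -> `|ip f g| <= c.
Proof.
move=> Hf Hg fc gc; have Hg' : H (- g).
  by rewrite -sub0r; apply: rkhs_sub => //; exact: rkhs_zero HK.
have := rkhs_ip_ge0 _ (rkhs_sub _ _ Hf Hg); rewrite rkhs_ip_norm_sub//.
have := rkhs_ip_ge0 _ (rkhs_sub _ _ Hf Hg'); rewrite rkhs_ip_norm_sub//.
rewrite (rkhs_ipC HK Hf Hg') !rkhs_ip_opp// (rkhs_ipC HK Hg Hg').
rewrite rkhs_ip_opp// (rkhs_ipC HK Hg Hf) => h1 h2.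
by rewrite ler_norml; apply/andP; split; lra.
Qed.

(** If [g] is the projection of [f] then [f - g] is orthogonal to [g], and the
squared norm of [f] is the sum of theirs.  If [f] has no projection on [V], then
[orth_proj ip V f] is the zero function. *)
Lemma orth_proj_contract (V : set (X -> R)) f : V `<=` H -> H f ->
  H (orth_proj ip V f) /\ ip (orth_proj ip V f) (orth_proj ip V f) <= ip f f.
Proof.
move=> VH Hf; rewrite /orth_proj; case: xgetP => [g _ [Vg gorth]|_].
  have Hg := VH _ Vg; split => //.
  have := gorth g Vg; have := rkhs_ip_ge0 _ (rkhs_sub _ _ Hf Hg).
  rewrite rkhs_ip_norm_sub// rkhs_ip_add//; last first.
    by rewrite -sub0r; apply: rkhs_sub => //; exact: rkhs_zero HK.
  by rewrite rkhs_ip_opp//; lra.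
have -> : point = 0 :> (X -> R) by [].
have H0 := rkhs_zero HK; rewrite rkhs_ip0l//.
by split=> //; exact: rkhs_ip_ge0.
Qed.

End rkhs.

Lemma mean_norm_le {R : realType} n (x : 'I_n -> R) c : 0 <= c ->
  (forall i, `|x i| <= c) -> `|n%:R^-1 * \sum_(i < n) x i| <= c.
Proof.
move=> c0 xc; rewrite normrM ger0_norm ?invr_ge0//.
case: n => [|n] in x xc *; first by rewrite invr0 mul0r.
rewrite mulrC ler_pdivrMr ?ltr0n//.
rewrite (le_trans (ler_norm_sum _ _ _))//.
rewrite (le_trans (ler_sum _ (fun i _ => xc i)))//.
by rewrite sumr_const card_ord mulr_natr.
Qed.

(** The direction is a mean of projected sections, with weights bounded by [C]
because the squared norm of a projected section is at most that of the section,
[K x x]. *)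
Lemma direction_lipschitz {R : realType} {d n : nat}
    (K : obs R d -> obs R d -> R)
    (HK : set (obs R d -> R)) (ip : (obs R d -> R) -> (obs R d -> R) -> R)
    (Ob : 'I_n -> obs R d) (alpha C L : R) p o o' :
  is_rkhs K HK ip -> 0 <= C -> 0 <= L -> (forall x, K x x <= C) ->
  (forall j, C1a_norm alpha (proj_section K HK ip p (Ob j)) <= L%:E)%E ->
  o.1.2 = o'.1.2 -> o.2 = o'.2 ->
  `|direction K HK ip Ob p o - direction K HK ip Ob p o'|
    <= C * L * cube_dist o.1.1 o'.1.1.
Proof.
move=> HKP C0 L0 KC pL ea eb.
have dE z : direction K HK ip Ob p z =
    n%:R^-1 * \sum_(j < n)
      (weight K HK ip Ob p j * proj_section K HK ip p (Ob j) z).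
  by rewrite /direction /= scalrfctE fct_sumE.
rewrite !dE -mulrBr -sumrB; apply: mean_norm_le => [|j].
  by rewrite !mulr_ge0// sqrtr_ge0.
rewrite -mulrBr normrM -mulrA ler_pM//; last exact: C1a_norm_lipschitz.
apply: mean_norm_le => // i.
have projC x : HK (proj_section K HK ip p x) /\
    ip (proj_section K HK ip p x) (proj_section K HK ip p x) <= C.
  have VH : mean_zero HK p `<=` HK by move=> f [].
  have [Hx xx] := orth_proj_contract K HK ip HKP _ _ VH (rkhs_kernel HKP x).
  split=> //; rewrite (le_trans xx)// (rkhs_reproducing HKP)//.
  exact: rkhs_kernel HKP x.
have [[Hi iC] [Hj jC]] := (projC (Ob i), projC (Ob j)).
exact: (rkhs_ip_le K HK ip HKP).
Qed.

(** * Mass of a ball around an observation *)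

(** The integral of a nonnegative function is a supremum over the simple
functions below it, so comparison and scaling hold without measurability: if [h]
is a simple function below [f] on [D], then [c * h] is one below [g]. *)
Lemma ge0_integral_scale_le {d} {T : measurableType d} {R : realType}
    (mu : {measure set T -> \bar R}) (D : set T) (f g : T -> R) (c : R) :
  0 < c -> (forall x, 0 <= f x) -> (forall x, 0 <= g x) ->
  (forall x, D x -> c * f x <= g x) ->
  (\int[mu]_(x in D) (f x)%:E <= c^-1%:E * \int[mu]_x (g x)%:E)%E.
Proof.
move=> c0 f0 g0 fg.
rewrite ge0_integralE; last by move=> x _; rewrite lee_fin.
rewrite ge0_integralTE; last by move=> x; rewrite lee_fin.
apply: ge_ereal_sup => _ [h /= hf <-].
rewrite lee_pdivlMl//.
rewrite -(sintegralrM mu c h).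
apply: ereal_sup_ubound; exists (scale_nnsfun h (ltW c0)) => //= x.
have := hf x; rewrite /patch; case: ifPn => xD; rewrite lee_fin => hx.
  rewrite lee_fin (le_trans _ (fg x (set_mem xD)))//.
  by rewrite ler_wpM2l// ltW.
by rewrite lee_fin (le_trans _ (g0 x))// pmulr_rle0.
Qed.

(** The function [q] has total mass [1] and dominates [c * p] on the ball. *)
Lemma density_ball_mass {R : realType} {d n : nat} (alpha M : R)
    (Ob : 'I_n -> obs R d) (p q : obs R d -> R) (w c : R) k :
  density_ball alpha M p -> density_ball alpha M q -> 0 < c ->
  (forall o, obs_ball Ob w k o -> c * p o <= q o) ->
  ball_mass Ob p w k <= c^-1.
Proof.
move=> [p0 _ _] [q0 q1 _] c0 pq.
have := ge0_integral_scale_le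
  (obs_measure R d) (obs_ball Ob w k) p q c c0 p0 q0 pq.
rewrite q1 mule1 /ball_mass /Rintegral.
have : (0 <= \int[obs_measure R d]_(x in obs_ball Ob w k) (p x)%:E)%E.
  by apply: integral_ge0 => x _; rewrite lee_fin.
by case: integral => [r _ |//|//]; rewrite lee_fin.
Qed.

(** * Growth along the flow *)

(** Logarithmic derivatives add up, also where some factor vanishes. *)
Lemma is_derive_prod_log_derivative {R : realType} n
    (f g : 'I_n -> R -> R) (t : R) :
  (forall k, is_derive t 1 (f k) (f k t * g k t)) ->
  is_derive t 1 (fun s => \prod_(k < n) f k s)
    (\prod_(k < n) f k t * \sum_(k < n) g k t).
Proof.
elim: n f g => [|n IH] f g fg.
  rewrite [X in is_derive _ _ _ X](_ : _ = 0); last by rewrite !big_ord0 mulr0.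
  rewrite (_ : (fun _ => _) = cst 1); first exact: is_derive_cst.
  by apply/funext => s; rewrite big_ord0.
have := IH (f \o lift ord0) (g \o lift ord0) (fun k => fg (lift ord0 k)).
move=> /(is_deriveM (fg ord0)); rewrite big_ord_recl big_ord_recl /=.
rewrite (_ : f ord0 * _ = (fun s => \prod_(k < n.+1) f k s)); last first.
  by apply/funext => s; rewrite big_ord_recl.
by move=> fp; apply: is_derive_eq fp _; rewrite /GRing.scale /=; ring.
Qed.

(** Multiplied by [expR (- c * t)], the product has the derivative
[product * expR (- c * t) * (\sum_k g k t - c)], which is nonnegative. *)
Lemma prod_exp_growth {R : realType} n (f g : 'I_n -> R -> R) (c T : R) :
  0 <= T ->
  (forall k t, t \in `[0, T] -> 0 <= f k t) ->
  (forall k t, t \in `[0, T] ->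
    derives_within `[0, T] (f k) t (f k t * g k t)) ->
  (forall t, t \in `[0, T] -> c <= \sum_(k < n) g k t) ->
  (\prod_(k < n) f k 0) * expR (c * T) <= \prod_(k < n) f k T.
Proof.
move=> T0 f0 fg gc.
pose phi := (fun s => \prod_(k < n) f k s) * (fun s => expR (- c * s)).
have dphi t : t \in `]0, T[ ->
    is_derive t 1 phi (\prod_(k < n) f k t * expR (- c * t)
                       * (\sum_(k < n) g k t - c)).
  move=> tT; have tT' : t \in `[0, T] by exact: subset_itv_oo_cc.
  have dp : is_derive t 1 (fun s => \prod_(k < n) f k s)
      (\prod_(k < n) f k t * \sum_(k < n) g k t).
    apply: is_derive_prod_log_derivative => k.
    by apply: derives_within_is_derive (tT) _; exact: fg.
  have de : is_derive t 1 (fun s => expR (- c * s)) (- c * expR (- c * t)).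
    have : is_derive t 1 ( *%R (- c)) (- c).
      have := is_deriveZ (- c) (is_derive_id t (1 : R)).
      by rewrite /GRing.scale /= mulr1.
    by move=> /(is_derive1_comp (is_derive_expR (- c * t))); rewrite mulrC.
  apply: is_derive_eq (is_deriveM dp de) _.
  by rewrite /GRing.scale /=; ring.
have : phi 0 <= phi T.
  apply: (ger0_derive1_ndecr _ _ _ (lexx 0) T0 (lexx T)).
  - by move=> t /dphi[].
  - move=> t tT; have tT' : t \in `[0, T] by exact: subset_itv_oo_cc.
    rewrite derive1E (derive_val (is_derive := dphi t tT)).
    rewrite mulr_ge0 ?mulr_ge0 ?expR_ge0 ?subr_ge0 ?gc//.
    by apply: prodr_ge0 => k _; exact: f0.
  - apply/subspace_continuousP => t /= tT; apply: cvgM; last first.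
      apply: cvg_within_filter.
      have : continuous (fun s : R => expR (- c * s)).
        move=> s; apply: continuous_comp; last exact: continuous_expR.
        exact: mulrl_continuous.
      exact.
    apply: (cvg_big (@mul_continuous R)) => k _.
    exact: derives_within_continuous (fg k t tT).
have phiE s : phi s = \prod_(k < n) f k s * expR (- c * s) by [].
rewrite !phiE mulr0 expR0 mulr1 mulNr expRN.
by rewrite -ler_pdivlMr ?invr_gt0 ?expR_gt0// invrK.
Qed.

(** The C^{1,alpha} norm dominates evaluation at each point [o], so convergence of
the difference quotients in that norm implies pointwise convergence. *)
Lemma C1_curve_derives_within {R : realType} {d : nat} (alpha T : R)
    (p q : R -> obs R d -> R) o t :
  C1_curve_with_derivative alpha T p q -> t \in `[0, T] ->
  derives_within `[0, T] (p^~ o) t (q t o).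
Proof.
move=> [_ _ dp _]; rewrite in_itv /= => tT.
apply/subr_cvg0/norm_cvg0P.
have -> : within [set h | `[0, T]%classic (t + h)] (0 : R)^'
    = within [set h | 0 <= t + h <= T] 0^'.
  by congr within; apply/funext => h /=; rewrite in_itv.
suff /fine_cvgP[_] : `|h^-1 * (p (t + h) o - p t o) - q t o|%:E
  @[h --> within [set h | 0 <= t + h <= T] 0^'] --> 0%E by [].
apply: squeeze_cvge (dp t tT); last exact: cvg_cst.
apply: filterE => h; rewrite lee_fin normr_ge0 /=.
exact: (C1a_norm_ub alpha (h^-1 *: (p (t + h) - p t) - q t)).
Qed.

(** * Early stopping *)

Theorem theorem6p3 (R : realType) (d n : nat)
  (Ob : 'I_n -> obs R d) (sigma : R) (sigma_gt0 : 0 < sigma)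
  (HK : set (obs R d -> R)) (ip : (obs R d -> R) -> (obs R d -> R) -> R)
  (HK_rkhs : is_rkhs (gauss_kernel sigma) HK ip)
  (alpha : R) (alpha_gt0 : 0 < alpha) (alpha_le1 : alpha <= 1)
  (M : R) (M_gt0 : 0 < M)
  (delta : R) (delta_gt0 : 0 < delta)
  (C_fin : kernel_sup (@gauss_kernel R d sigma) \is a fin_num)
  (MK_fin : kernel_C1a_sup (@gauss_kernel R d sigma) alpha \is a fin_num)
  (M1a_fin : section_C1a_sup (gauss_kernel sigma) HK ip alpha Ob M
             \is a fin_num)
  (p0 : obs R d -> R) (p0_ball : density_ball alpha M p0) :
  let K := @gauss_kernel R d sigma in
  let C := fine (kernel_sup K) in
  let M1a := fine (section_C1a_sup K HK ip alpha Ob M) in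
  let w := ball_radius delta C M1a in
  let J := inv_mass_max Ob p0 w in
  let T := horizon delta J in
  let M0 := fine (C1a_norm alpha p0) in
  forall (mass_gt0 : forall k, 0 < ball_mass Ob p0 w k)
    (M_eq : M = M0 * expR (C_alg d alpha * C * M1a * T))
    (p : R -> obs R d -> R)
    (p_sol : is_solution K HK ip alpha Ob M T p0 p)
    (p_unique : forall q, is_solution K HK ip alpha Ob M T p0 q ->
       forall t, 0 <= t <= T -> q t = p t),
  exists2 t : R, 0 <= t <= T
    & empirical Ob (direction K HK ip Ob (p t)) <= delta.
Proof.
move=> K C M1a w J T M0 mass_gt0 _ p [p0E pM dp] _.
(* Without observations, [J = 0] and [T = 0], since [ln 0 = 0]. *)
have [n0|n_gt0] := posnP n.
  have J0 : J = 0 by rewrite /J /inv_mass_max; subst n; rewrite big_ord0.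
  exists 0; first by rewrite /T /horizon J0 mulr0 ln0// mulr0 lexx.
  by rewrite /empirical; subst n; rewrite big_ord0 mulr0 ltW.
have KC x : K x x <= C.
  by rewrite -lee_fin fineK//; apply: ereal_sup_ubound; exists x.
have C_ge0 : 0 <= C := le_trans (expR_ge0 _) (KC point).
have projM q j : density_ball alpha M q ->
    (C1a_norm alpha (proj_section K HK ip q (Ob j)) <= M1a%:E)%E.
  by move=> qM; rewrite fineK//; apply: ereal_sup_ubound; exists (q, j).
have M1a_ge0 : 0 <= M1a.
  have := projM p0 (Ordinal n_gt0) p0_ball.
  by rewrite -lee_fin; apply: le_trans; exact: C1a_norm_ge0.
have mass_J k : 1 <= J * ball_mass Ob p0 w k.
  rewrite -ler_pdivrMr// div1r.
  exact: (le_bigmax 0 (fun k => (ball_mass Ob p0 w k)^-1) k).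
have J_ge1 : 1 <= J.
  have k := Ordinal n_gt0; rewrite (le_trans (mass_J k))// ler_piMr//.
    by rewrite /J /inv_mass_max; exact: bigmax_ge_id.
  rewrite -[leRHS]invr1.
  by apply: (density_ball_mass alpha M Ob p0 p0) => // o _; rewrite mul1r.
have T_ge0 : 0 <= T.
  by rewrite /T /horizon mulr_ge0 ?divr_ge0 ?ln_ge0 ?(ltW delta_gt0)//; lra.
have expT : expR (delta / 2 * T) = 2 * J.
  rewrite /T /horizon mulrA (_ : delta / 2 * _ = 1) ?mul1r ?lnK ?posrE//.
    lra.
  by field; rewrite gt_eqF.
have TT : T \in `[0, T] by rewrite in_itv /= T_ge0 lexx.
apply: contrapT => nex.
have empD t : t \in `[0, T] ->
    delta < empirical Ob (direction K HK ip Ob (p t)).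
  rewrite in_itv /= => tT; rewrite ltNge.
  by apply/negP => ?; apply: nex; exists t.
(* Otherwise the ball around [Ob k] would have mass at least [2] at time [T]. *)
have low k : exists2 o, obs_ball Ob w k o & p T o < expR (delta / 2 * T) * p0 o.
  apply: contrapT => nlow.
  have := mass_J k; apply/negP; rewrite -ltNge expT in nlow *.
  have mass_le : ball_mass Ob p0 w k <= (2 * J)^-1.
    apply: (density_ball_mass alpha M Ob p0 (p T)) => //.
    - by apply: pM; exact: TT.
    - lra.
    - by move=> o oB; rewrite leNgt; apply/negP => ?; apply: nlow; exists o.
  have J0 : 0 < J by lra.
  rewrite (le_lt_trans (ler_wpM2l (ltW J0) mass_le))//.
  have -> : J * (2 * J)^-1 = 2^-1 by field; rewrite gt_eqF.
  lra.
pose z k := s2val (cid2 (low k)).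
have zB k : obs_ball Ob w k (z k) := s2valP (cid2 (low k)).
have z_low k : p T (z k) < expR (delta / 2 * T) * p0 (z k) :=
  s2valP' (cid2 (low k)).
have Dz t k : t \in `[0, T] -> direction K HK ip Ob (p t) (Ob k) - delta / 2
    <= direction K HK ip Ob (p t) (z k).
  move=> tT; have [ea eb zw] := zB k.
  have := direction_lipschitz K HK ip Ob alpha C M1a (p t) (z k) (Ob k)
    HK_rkhs C_ge0 M1a_ge0 KC (fun j => projM _ j (pM t tT)) ea eb.
  suff : C * M1a * cube_dist (z k).1.1 (Ob k).1.1 <= delta / 2.
    by rewrite ler_norml => ? /andP[? ?]; lra.
  rewrite (le_trans (ler_wpM2l (mulr_ge0 C_ge0 M1a_ge0) (ltW zw)))//.
  rewrite /w /ball_radius; have [->|CM0] := eqVneq (C * M1a) 0.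
    by rewrite mul0r divr_ge0// ltW.
  rewrite le_eqVlt; apply/orP; left; apply/eqP.
  by move: CM0; rewrite mulf_eq0 negb_or => /andP[C0 M0']; field; rewrite M0'.
have growth := prod_exp_growth n (fun k t => p t (z k))
  (fun k t => direction K HK ip Ob (p t) (z k)) (n%:R * (delta / 2)) T T_ge0.
have : \prod_(k < n) p T (z k)
    < \prod_(k < n) (expR (delta / 2 * T) * p0 (z k)).
  apply: ltr_prod.
    by apply/hasP; exists (Ordinal n_gt0); rewrite ?mem_index_enum.
  by move=> k _; rewrite z_low andbT; have [pT0 _ _] := pM T TT; exact: pT0.
apply/negP; rewrite -leNgt big_split /= prodr_const card_ord mulrC.
rewrite -expRM_natl mulrA -p0E; apply: growth.
- by move=> k t tT; have [pt0 _ _] := pM t tT; exact: pt0.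
- by move=> k t tT; exact: C1_curve_derives_within dp tT.
- move=> t tT; have := empD t tT; rewrite /empirical ltr_pdivlMl ?ltr0n//.
  move=> /ltW Hd; apply: le_trans (ler_sum _ (fun k _ => Dz t k tT)).
  by rewrite sumrB sumr_const card_ord -mulr_natl; lra.
Qed.
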